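(* Let $p$ be an odd prime and let $G=\langle a,b,c,d,e \mid a^{p}=b^{p}=c^{p}=d^{p}=e^{p}=1,\ ab=ba,\ ac=ca,\ ad=da,\ ae=eac,\ bc=cb,\ bd=db,\ be=ebd,\ cd=dc,\ ce=ec,\ de=ed\rangle$ (a group of order $p^5$). Then $Aut_c(G)\simeq \mathbb{Z}_p\times\mathbb{Z}_p\times\mathbb{Z}_p\times\mathbb{Z}_p\times\mathbb{Z}_p\times\mathbb{Z}_p$.
   Context: An automorphism $\theta$ of a group $G$ is central if $g^{-1}\theta(g)\in Z(G)$ for all $g\in G$; $Aut_c(G)$ is the group of all central automorphisms of $G$ under composition. $\mathbb{Z}_p$ denotes the cyclic group of order $p$. *)

(* Defs.v *)
From mathcomp Require Import all_boot all_fingroup all_solvable.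
From mathcomp Require Import zmodp.

Set Implicit Arguments.
Unset Strict Implicit.
Unset Printing Implicit Defensive.

Local Open Scope group_scope.

Definition Aut_c (gT : finGroupType) (G : {set gT}) : {set {perm gT}} :=
  [set f in Aut G | [forall x in G, x^-1 * f x \in 'Z(G)]].

Lemma Aut_cP (gT : finGroupType) (G : {set gT}) (f : {perm gT}) :
  reflect (f \in Aut G /\ {in G, forall x, x^-1 * f x \in 'Z(G)})
          (f \in Aut_c G).
Proof.
by rewrite [f \in Aut_c G]in_set; apply: (iffP andP) => -[Af /forall_inP].
Qed.

Lemma Aut_c_group_set (gT : finGroupType) (G : {group gT}) :
  group_set (Aut_c G).
Proof.
apply/group_setP; split=> [|f h].
  by apply/Aut_cP; split=> [|x Gx]; rewrite ?perm1 ?mulVg ?group1.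
case/Aut_cP=> [Af Zf] /Aut_cP[Ah Zh].
apply/Aut_cP; split=> [|x Gx]; first exact: groupM.
have Gfx: f x \in G by rewrite Aut_closed.
by rewrite permM -(mulKVg (f x) (h _)) mulgA groupM ?Zf ?Zh.
Qed.

Canonical Aut_c_group (gT : finGroupType) (G : {group gT}) :=
  Group (Aut_c_group_set G).

(* Main.v *)
Require Import Defs.
From HB Require Import structures.
From mathcomp Require Import all_boot all_fingroup all_solvable.
From mathcomp Require Import zmodp.
From mathcomp Require Import ssralg ring.

Local Open Scope group_scope.

(** The relations make c and d central and commutators of the other generators
with e, so every element of G has the form e^k a^i b^j c^l d^m with exponents
mod p, and these words multiply by adding exponents, with an extra i k' in the
exponent of c and j k' in that of d, because a^i e^k' = e^k' a^i c^(i k').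
Taking this multiplication as the definition of a group law on (Z/p)^5 gives a
group of order p^5 which is generated by elements satisfying the relations
([model_presented]) and maps onto every other group generated in this way
([wordM], [im_word]); hence it is isomorphic to G.

In the model the center is the set of words c^l d^m, and it is contained in
the derived subgroup. A central automorphism therefore fixes c and d, which are
commutators, and is determined by the three central elements by which it
multiplies e, a and b. Conversely, any three central elements arise: adding to
the (c, d) coordinates of x a (Z/p)-linear function of its (e, a, b)
coordinates is an automorphism ([twistM]), because that function is a
homomorphism to the center. The six coefficients of this linear function add
up under composition, since the (e, a, b) coordinates do not change. This
identifies the group of central automorphisms with (Z/p)^6 ([injm_twist],
[im_twist]), and [isog_Aut_c] carries the result over to G. *)

(** * Isomorphism invariance of the group of central automorphisms *)

Section Invariance.

Variables (aT rT : finGroupType) (G : {group aT}).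

Lemma Aut_isom_central (f : {morphism G >-> rT}) (injf : 'injm f) :
  Aut_isom injf (subxx G) @* Aut_c G \subset Aut_c (f @* G).
Proof.
apply/subsetP=> _ /morphimP[u _ /Aut_cP[Au Zu] ->].
apply/Aut_cP; split=> [|_ /morphimP[x Dx Gx ->]]; first exact: Aut_Aut_isom.
have Gux : u x \in G by rewrite Aut_closed.
rewrite Aut_isomE // -morphV // -morphM ?groupV //.
by rewrite -injm_center // mem_morphim ?Zu ?groupM ?groupV.
Qed.

Lemma Aut_c_sub_Aut : Aut_c G \subset Aut G.
Proof. by apply/subsetP=> u /Aut_cP[]. Qed.

Lemma card_Aut_c_le (H : {group rT}) : G \isog H -> #|Aut_c G| <= #|Aut_c H|.
Proof.
case/isogP=> f injf <-.
rewrite -(card_injm (injm_Aut_isom injf (subxx G)) Aut_c_sub_Aut).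
exact: subset_leq_card (Aut_isom_central _ injf).
Qed.

End Invariance.

(** Transport along the isomorphism embeds each group of central automorphisms
in the other, so by finiteness the embeddings are onto. *)
Lemma isog_Aut_c (aT rT : finGroupType) (G : {group aT}) (H : {group rT}) :
  G \isog H -> Aut_c G \isog Aut_c H.
Proof.
move=> isoGH; have [f injf im_f] := isogP isoGH.
have injF := injm_Aut_isom injf (subxx G).
have sAG := Aut_c_sub_Aut _ G.
have -> : Aut_c H = Aut_isom injf (subxx G) @* Aut_c G.
  apply/eqP; rewrite eq_sym eqEcard -{1}im_f Aut_isom_central /=.
  by rewrite card_injm //; apply: card_Aut_c_le; rewrite isog_sym.
exact: (sub_isog sAG injF).
Qed.

(** * The presentation *)

Record relations (p : nat) (gT : finGroupType) (a b c d e : gT) : Prop :=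
  Relations {
    powers : [/\ a ^+ p = 1, b ^+ p = 1, c ^+ p = 1, d ^+ p = 1 & e ^+ p = 1];
    commuting : [/\ a * b = b * a, a * c = c * a, a * d = d * a,
                    b * c = c * b & b * d = d * b];
    central : [/\ c * d = d * c, c * e = e * c & d * e = e * d];
    conjugation : a * e = e * a * c /\ b * e = e * b * d }.

Notation presented p H := (H \homg Grp (a : b : c : d : e :
  a ^+ p = 1, b ^+ p = 1, c ^+ p = 1, d ^+ p = 1, e ^+ p = 1,
  a * b = b * a, a * c = c * a, a * d = d * a, a * e = e * a * c,
  b * c = c * b, b * d = d * b, b * e = e * b * d,
  c * d = d * c, c * e = e * c, d * e = e * d)).

(** Replaces the single equality of nested tuples to which the presentation
unfolds by separate equations. *)
Lemma presentedP (p : nat) (gT : finGroupType) (H : {set gT}) :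
  presented p H <->
  exists a b c d e : gT,
    <[a]> <*> <[b]> <*> <[c]> <*> <[d]> <*> <[e]> = H /\ relations p gT a b c d e.
Proof.
split=> [/existsP[[[[[a b] c] d] e]] /eqP[defH] * | [a [b [c [d [e [defH]]]]]]].
  by exists a, b, c, d, e; split=> //; do !split.
move=> [[? ? ? ? ?] [? ? ? ? ?] [? ? ?] [? ?]].
by apply/existsP; exists (a, b, c, d, e); apply/eqP; do ![congr pair => //].
Qed.

Lemma mem_join_cycles (gT : finGroupType) (a b c d e : gT)
    (H := <[a]> <*> <[b]> <*> <[c]> <*> <[d]> <*> <[e]>) :
  [/\ a \in H, b \in H, c \in H, d \in H & e \in H].
Proof.
have memL (A B : {set gT}) y : y \in A -> y \in A <*> B.
  exact: (subsetP (joing_subl A B)).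
have memR (A : {set gT}) y : y \in A <*> <[y]>.
  by apply: (subsetP (joing_subr A _)); apply: cycle_id.
by split; do ?[exact: memR | exact: cycle_id | apply/memL].
Qed.

(** * A concrete model of the presented group *)

Section Model.

Variable p : nat.

(** [Model k i j l m] stands for the word e^k a^i b^j c^l d^m. A fresh record
keeps the group law apart from the direct product law that tuples over 'Z_p
already carry. *)
Record model := Model { ce : 'Z_p; ca : 'Z_p; cb : 'Z_p; cc : 'Z_p; cd : 'Z_p }.

Local Open Scope ring_scope.

Definition coords (x : model) := (ce x, ca x, cb x, cc x, cd x).
Definition of_coords t := let: (k, i, j, l, m) := t in Model k i j l m.

Lemma coordsK : cancel coords of_coords. Proof. by case. Qed.
Lemma of_coordsK : cancel of_coords coords. Proof. by case=> [[[[? ?] ?] ?] ?]. Qed.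

HB.instance Definition _ := Finite.copy model (can_type coordsK).

Definition model_one := Model 0 0 0 0 0.
(** The products [ca x * ce y] and [cb x * ce y] come from moving the power of e
in y to the left past the powers of a and b in x. *)
Definition model_mul x y :=
  Model (ce x + ce y) (ca x + ca y) (cb x + cb y)
        (cc x + cc y + ca x * ce y) (cd x + cd y + cb x * ce y).
Definition model_inv x :=
  Model (- ce x) (- ca x) (- cb x)
        (- cc x + ca x * ce x) (- cd x + cb x * ce x).

Lemma model_mulA : associative model_mul.
Proof. by move=> x y z; rewrite /model_mul /=; congr Model; ring. Qed.
Lemma model_mul1 : left_id model_one model_mul.
Proof. by case=> *; rewrite /model_mul /=; congr Model; ring. Qed.
Lemma model_mulV : left_inverse model_one model_inv model_mul.
Proof.
by move=> x; rewrite /model_mul /model_one /=; congr Model; ring.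
Qed.

HB.instance Definition _ :=
  Finite_isGroup.Build model model_mulA model_mul1 model_mulV.

Lemma mul_model (x y : model) : (x * y)%g = model_mul x y.
Proof. by []. Qed.

Definition gen_a := Model 0 1 0 0 0.
Definition gen_b := Model 0 0 1 0 0.
Definition gen_c := Model 0 0 0 1 0.
Definition gen_d := Model 0 0 0 0 1.
Definition gen_e := Model 1 0 0 0 0.

Lemma card_model : (1 < p)%N -> #|[set: model]| = (p ^ 5)%N.
Proof.
move=> p_gt1; rewrite cardsT (bij_eq_card (Bijective coordsK of_coordsK)).
by rewrite !card_prod !card_ord Zp_cast // -!mulnA.
Qed.

(** Common form of the five embeddings of 'Z_p as the cyclic subgroup of one
generator. *)
Definition on_axis (g : 'Z_p -> model) :=
  forall r s, (g r * g s)%g = g (r + s).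

Lemma axis_expg (g : 'Z_p -> model) n :
  on_axis g -> g 0 = 1%g -> (g 1%R ^+ n)%g = g n%:R.
Proof.
move=> gD g0; elim: n => [|n IHn]; first by rewrite expg0 g0.
by rewrite expgS IHn gD -GRing.mulrS.
Qed.

Definition axis_a r := Model 0 r 0 0 0.
Definition axis_b r := Model 0 0 r 0 0.
Definition axis_c r := Model 0 0 0 r 0.
Definition axis_d r := Model 0 0 0 0 r.
Definition axis_e r := Model r 0 0 0 0.

Lemma axis_morph : [/\ on_axis axis_a, on_axis axis_b, on_axis axis_c,
  on_axis axis_d & on_axis axis_e].
Proof. by split=> r s; rewrite mul_model /model_mul /=; congr Model; ring. Qed.

Lemma gen_expg n : [/\ (gen_a ^+ n)%g = axis_a n%:R, (gen_b ^+ n)%g = axis_b n%:R,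
  (gen_c ^+ n)%g = axis_c n%:R, (gen_d ^+ n)%g = axis_d n%:R
  & (gen_e ^+ n)%g = axis_e n%:R].
Proof.
have [Da Db Dc Dd De] := axis_morph.
split; [exact: (axis_expg axis_a) | exact: (axis_expg axis_b)
  | exact: (axis_expg axis_c) | exact: (axis_expg axis_d)
  | exact: (axis_expg axis_e)].
Qed.

Lemma model_normal_form (x : model) :
  x = (gen_e ^+ ce x * gen_a ^+ ca x * gen_b ^+ cb x
       * gen_c ^+ cc x * gen_d ^+ cd x)%g.
Proof.
case: x => k i j l m /=.
case: (gen_expg k) (gen_expg i) (gen_expg j) (gen_expg l) (gen_expg m).
move=> _ _ _ _ -> [-> _ _ _ _] [_ -> _ _ _] [_ _ -> _ _] [_ _ _ -> _].
rewrite !natr_Zp !mul_model /model_mul /=; congr Model; ring.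
Qed.

Lemma model_relations :
  (1 < p)%N -> relations p _ gen_a gen_b gen_c gen_d gen_e.
Proof.
move=> p_gt1; split; first by have [-> -> -> -> ->] := gen_expg p; rewrite pchar_Zp.
all: by split; rewrite !mul_model /model_mul /=; congr Model; ring.
Qed.

Lemma model_presented : (1 < p)%N -> presented p [set: model].
Proof.
move=> p_gt1; apply/presentedP; exists gen_a, gen_b, gen_c, gen_d, gen_e.
split; last exact: model_relations.
apply/eqP; rewrite eqEsubset subsetT; apply/subsetP=> x _.
have [Ha Hb Hc Hd He] := mem_join_cycles _ gen_a gen_b gen_c gen_d gen_e.
by rewrite [x]model_normal_form !groupM ?groupX.
Qed.

(** * The model maps onto every group with these generators and relations *)

Section Hom.

Variables (gT : finGroupType) (a b c d e : gT).
Hypothesis (rels : relations p gT a b c d e) (p_gt1 : (1 < p)%N).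

Local Open Scope group_scope.

Definition word (x : model) : gT :=
  e ^+ ce x * (a ^+ ca x * b ^+ cb x) * (c ^+ cc x * d ^+ cd x).

Lemma expg_ZpD (g : gT) (r s : 'Z_p) :
  g ^+ p = 1 -> g ^+ (r + s)%R = g ^+ r * g ^+ s.
Proof.
move=> gp; rewrite -expgD -[RHS](expg_mod _ gp) /=; congr (g ^+ (_ %% _)).
exact: Zp_cast.
Qed.

Lemma expg_ZpM (g : gT) (r s : 'Z_p) :
  g ^+ p = 1 -> g ^+ (r * s)%R = g ^+ (r * s)%N.
Proof.
move=> gp; rewrite -[RHS](expg_mod _ gp) /=; congr (g ^+ (_ %% _)).
exact: Zp_cast.
Qed.

Lemma expg_shift (x y z : gT) i j : x * y = y * x * z -> commute x z ->
  commute y z -> x ^+ i * y ^+ j = y ^+ j * x ^+ i * z ^+ (i * j).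
Proof.
move=> xy cxz cyz.
have def_z : [~ x, y] = z by apply: (mulgI (y * x)); rewrite -commgC.
by rewrite commgC commXXg ?def_z.
Qed.

Lemma commute_shift (x y : gT) i j t : commute x y ->
  x ^+ i * (y ^+ j * t) = y ^+ j * (x ^+ i * t).
Proof. by move=> cxy; rewrite !mulgA (commuteX2 i j cxy). Qed.

(** Collection: powers of e are moved left, producing the corrections
c^(i k') and d^(j k'), and the remaining powers, which commute, are sorted. *)
Lemma wordM : {in setT &, {morph word : x y / x * y}}.
Proof.
case: rels => [[ap bp cp dp ep] [ab ac ad bc bd] [cd ce' de] [ae be]] x y _ _.
case: x y => k i j l m [k' i' j' l' m'].
have ba := commute_sym ab; have ca' := commute_sym ac; have da := commute_sym ad.
have cb' := commute_sym bc; have db := commute_sym bd; have dc := commute_sym cd.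
have shift_a r s t : a ^+ r * (e ^+ s * t) = e ^+ s * (a ^+ r * (c ^+ (r * s) * t)).
  by rewrite !mulgA (expg_shift _ _ c).
have shift_b r s t : b ^+ r * (e ^+ s * t) = e ^+ s * (b ^+ r * (d ^+ (r * s) * t)).
  by rewrite !mulgA (expg_shift _ _ d).
rewrite mul_model /word /model_mul /ce /ca /cb /cc /cd.
(* A trailing 1 lets the shift rules, which need a right factor, reach the last
   letter of the word. *)
rewrite !expg_ZpD ?expg_ZpM // -[LHS]mulg1 -[RHS]mulg1 -!mulgA.
do ![rewrite shift_a | rewrite shift_b
  | rewrite (commute_shift c e) // | rewrite (commute_shift d e) //
  | rewrite (commute_shift b a) // | rewrite (commute_shift c a) //
  | rewrite (commute_shift d a) // | rewrite (commute_shift c b) //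
  | rewrite (commute_shift d b) // | rewrite (commute_shift d c) //].
have merge (g : gT) r s t : g ^+ r * (g ^+ s * t) = g ^+ (r + s) * t.
  by rewrite mulgA expgD.
by rewrite !merge (addnC (l + l')%N) (addnC (m + m')%N) !addnA.
Qed.

Canonical word_morphism := Morphism wordM.

Lemma word_gens : [/\ word gen_a = a, word gen_b = b, word gen_c = c,
  word gen_d = d & word gen_e = e].
Proof.
by split; rewrite /word /= !(expg0, expg1, mulg1, mul1g).
Qed.

Lemma im_word : word @* [set: model] = <[a]> <*> <[b]> <*> <[c]> <*> <[d]> <*> <[e]>.
Proof.
apply/eqP; rewrite eqEsubset; apply/andP; split.
  apply/subsetP=> _ /morphimP[x _ _ ->].
  have [Ha Hb Hc Hd He] := mem_join_cycles _ a b c d e.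
  by rewrite /= /word !groupM ?groupX.
have [wa wb wc wd we] := word_gens.
rewrite !join_subG !cycle_subG /= -{1}wa -{1}wb -{1}wc -{1}wd -{1}we.
by rewrite !mem_morphim ?inE.
Qed.

End Hom.

Lemma model_isoGrp : (1 < p)%N ->
  [set: model] \isog Grp (a : b : c : d : e :
    a ^+ p = 1, b ^+ p = 1, c ^+ p = 1, d ^+ p = 1, e ^+ p = 1,
    a * b = b * a, a * c = c * a, a * d = d * a, a * e = e * a * c,
    b * c = c * b, b * d = d * b, b * e = e * b * d,
    c * d = d * c, c * e = e * c, d * e = e * d).
Proof.
move=> p_gt1; apply: intro_isoGrp; first exact: model_presented.
move=> gT H /presentedP[a [b [c [d [e [<- rels]]]]]].
by rewrite -(im_word _ _ _ _ _ _ rels p_gt1); apply: morphim_homg.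
Qed.

(** * Central automorphisms of the model *)

Lemma model_center_sub (z : model) : z \in 'Z([set: model])%g ->
  [/\ ce z = 0, ca z = 0 & cb z = 0].
Proof.
case/centerP=> _ cz; case: z cz => k i j l m cz.
have hi : l + 0 + i * 1 = 0 + l + 0 * k := congr1 cc (cz gen_e (in_setT _)).
have hj : m + 0 + j * 1 = 0 + m + 0 * k := congr1 cd (cz gen_e (in_setT _)).
have hk : l + 0 + i * 0 = 0 + l + 1 * k := congr1 cc (cz gen_a (in_setT _)).
split=> /=; apply: (GRing.addrI l).
- by transitivity (0 + l + 1 * k); [ring | rewrite -hk; ring].
- by transitivity (l + 0 + i * 1); [ring | rewrite hi; ring].
apply: (GRing.addrI m); transitivity (l + (m + 0 + j * 1)); first by ring.
by rewrite hj; ring.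
Qed.

Definition params := ('Z_p * 'Z_p * 'Z_p * 'Z_p * 'Z_p * 'Z_p)%type.

(** The automorphism with e -> e c^x1 d^x4, a -> a c^x2 d^x5, b -> b c^x3 d^x6. *)
Definition twist (t : params) (x : model) : model :=
  let: (x1, x2, x3, x4, x5, x6) := t in
  Model (ce x) (ca x) (cb x)
    (cc x + (ce x * x1 + ca x * x2 + cb x * x3))
    (cd x + (ce x * x4 + ca x * x5 + cb x * x6)).

Lemma twist1 x : twist 1%g x = x.
Proof.
case: x => k i j l m; congr Model.
  by transitivity (l + (k * 0 + i * 0 + j * 0)) => //; ring.
by transitivity (m + (k * 0 + i * 0 + j * 0)) => //; ring.
Qed.

Lemma twist_comp s t x : twist t (twist s x) = twist (s * t)%g x.
Proof.
case: s t => [[[[[x1 x2] x3] x4] x5] x6] [[[[[y1 y2] y3] y4] y5] y6] /=.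
congr Model.
  transitivity (cc x + (ce x * (x1 + y1) + ca x * (x2 + y2) + cb x * (x3 + y3))) => //.
  ring.
transitivity (cd x + (ce x * (x4 + y4) + ca x * (x5 + y5) + cb x * (x6 + y6))) => //.
ring.
Qed.

Lemma twist_inj t : injective (twist t).
Proof.
by apply: (@can_inj _ _ _ (twist t^-1%g)) => x; rewrite twist_comp mulgV twist1.
Qed.

Definition twist_perm t : {perm model} := perm (twist_inj t).

Lemma twistM t : {morph twist t : x y / (x * y)%g}.
Proof.
case: t => [[[[[x1 x2] x3] x4] x5] x6] x y.
by rewrite !mul_model /model_mul /=; congr Model; ring.
Qed.

Lemma twist_permM : {in setT &, {morph twist_perm : s t / (s * t)%g}}.
Proof. by move=> s t _ _; apply/permP=> x; rewrite permM !permE twist_comp. Qed.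

Canonical twist_morphism := Morphism twist_permM.

Lemma twist_gens x1 x2 x3 x4 x5 x6 (t := (x1, x2, x3, x4, x5, x6)) :
  [/\ twist t gen_e = Model 1 0 0 x1 x4, twist t gen_a = Model 0 1 0 x2 x5
    & twist t gen_b = Model 0 0 1 x3 x6].
Proof. by split; rewrite /t /=; congr Model; ring. Qed.

Lemma injm_twist : 'injm twist_morphism.
Proof.
apply/injmP=> s t _ _ /permP eq_st.
have := (eq_st gen_e, eq_st gen_a, eq_st gen_b); rewrite !permE.
case: s t {eq_st} => [[[[[x1 x2] x3] x4] x5] x6] [[[[[y1 y2] y3] y4] y5] y6].
have [-> -> ->] := twist_gens x1 x2 x3 x4 x5 x6.
have [-> -> ->] := twist_gens y1 y2 y3 y4 y5 y6.
move=> [[/(congr1 coords)[e1 e4] /(congr1 coords)[e2 e5]] /(congr1 coords)[e3 e6]].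
by rewrite e1 e2 e3 e4 e5 e6.
Qed.

Lemma model_center_sup (z : model) : ce z = 0 -> ca z = 0 -> cb z = 0 ->
  z \in 'Z([set: model])%g.
Proof.
case: z => k i j l m /= -> -> ->; apply/centerP; split=> [|y _]; first exact: in_setT.
by rewrite /commute !mul_model /model_mul /=; congr Model; ring.
Qed.

Lemma twist_Aut_c t : twist_perm t \in Aut_c [set: model].
Proof.
apply/Aut_cP; split=> [|x _].
  rewrite inE; apply/andP; split; first by apply/subsetP=> x; rewrite inE.
  by apply/morphicP=> x y _ _; rewrite !permE twistM.
rewrite permE; apply: model_center_sup;
by case: t => [[[[[x1 x2] x3] x4] x5] x6]; rewrite mul_model /=; ring.
Qed.

Lemma comm_ae : [~ gen_a, gen_e]%g = gen_c.
Proof.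
apply: (mulgI (gen_e * gen_a)%g); rewrite -commgC !mul_model /model_mul /=.
by congr Model; ring.
Qed.

Lemma comm_be : [~ gen_b, gen_e]%g = gen_d.
Proof.
apply: (mulgI (gen_e * gen_b)%g); rewrite -commgC !mul_model /model_mul /=.
by congr Model; ring.
Qed.

(** The elements a, b, e generate the model, because c and d are commutators. *)
Lemma Aut_ext_abe (f g : {perm model}) : f \in Aut [set: model] ->
  g \in Aut [set: model] -> f gen_a = g gen_a -> f gen_b = g gen_b ->
  f gen_e = g gen_e -> f = g.
Proof.
move=> Af Ag fa fb fe; apply: (eq_Aut Af Ag) => x _.
have ext u : u \in Aut [set: model] -> {morph u : x y / (x * y)%g}.
  by move=> Au y z; apply: (morphicP (Aut_morphic Au)); rewrite inE.
have fM := ext f Af; have gM := ext g Ag.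
(* The points where f and g agree form a subgroup. *)
have gK : group_set [set y | f y == g y].
  apply/group_setP; split=> [|y z]; rewrite !inE.
    have one (u : {perm model}) : {morph u : y z / (y * z)%g} -> u 1%g = 1%g.
      by move=> uM; apply: (mulgI (u 1%g)); rewrite -uM !mulg1.
    by rewrite !one.
  by rewrite fM gM => /eqP-> /eqP->.
suff : x \in Group gK by rewrite inE => /eqP.
have [Ka Kb Ke] : [/\ gen_a \in Group gK, gen_b \in Group gK & gen_e \in Group gK].
  by rewrite !inE fa fb fe.
have -> : x = (gen_e ^+ ce x * gen_a ^+ ca x * gen_b ^+ cb x
       * [~ gen_a, gen_e] ^+ cc x * [~ gen_b, gen_e] ^+ cd x)%g.
  by rewrite {1}[x]model_normal_form comm_ae comm_be.
by rewrite !groupM ?groupX ?groupR.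
Qed.

(** The coefficients of the twist that equals f are the coordinates of the
central elements x^-1 f(x) for x = e, a, b. *)
Lemma im_twist : twist_perm @* [set: params] = Aut_c [set: model].
Proof.
apply/eqP; rewrite eqEsubset; apply/andP; split.
  by apply/subsetP=> _ /morphimP[t _ _ ->]; apply: twist_Aut_c.
apply/subsetP=> f /Aut_cP[Af Zf].
have /model_center_sub := Zf gen_e (in_setT _).
have /model_center_sub := Zf gen_a (in_setT _).
have /model_center_sub := Zf gen_b (in_setT _).
set zb := (gen_b^-1 * _)%g; set za := (gen_a^-1 * _)%g; set ze := (gen_e^-1 * _)%g.
move=> [b1 b2 b3] [a1 a2 a3] [e1 e2 e3].
pose t : params := (cc ze, cc za, cc zb, cd ze, cd za, cd zb).
suff -> : f = twist_perm t by rewrite mem_morphim ?inE.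
have /Aut_cP[At _] := twist_Aut_c t.
have split_z (z : model) : ce z = 0 -> ca z = 0 -> cb z = 0 ->
    z = Model 0 0 0 (cc z) (cd z).
  by case: z => ? ? ? ? ? /= -> -> ->.
apply: Aut_ext_abe => //; rewrite permE /=.
- rewrite -[LHS](mulKVg gen_a) -/za (split_z za) // mul_model /model_mul /=.
  by congr Model; ring.
- rewrite -[LHS](mulKVg gen_b) -/zb (split_z zb) // mul_model /model_mul /=.
  by congr Model; ring.
rewrite -[LHS](mulKVg gen_e) -/ze (split_z ze) // mul_model /model_mul /=.
by congr Model; ring.
Qed.

Lemma Aut_c_model : Aut_c [set: model] \isog [set: params].
Proof.
rewrite -im_twist isog_sym; exact: sub_isog (subxx _) injm_twist.
Qed.

End Model.

(** * The presented group and its central automorphisms *)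

Theorem mainTheorem2 (p : nat) (p_pr : prime p) (p_odd : odd p)
    (gT : finGroupType) (G : {group gT})
    (presG : G \isog Grp (a : b : c : d : e :
       a ^+ p = 1, b ^+ p = 1, c ^+ p = 1, d ^+ p = 1, e ^+ p = 1,
       a * b = b * a, a * c = c * a, a * d = d * a, a * e = e * a * c,
       b * c = c * b, b * d = d * b, b * e = e * b * d,
       c * d = d * c, c * e = e * c, d * e = e * d)) :
  #|G| = (p ^ 5)%N /\
  Aut_c G \isog [set: 'Z_p * 'Z_p * 'Z_p * 'Z_p * 'Z_p * 'Z_p].
Proof.
have p_gt1 := prime_gt1 p_pr.
have isoG : G \isog [set: model p].
  rewrite isogEhom presG model_presented // andbT.
  by rewrite model_isoGrp // isoGrp_hom.
split; first by rewrite (card_isog isoG) card_model.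
exact: isog_trans (isog_Aut_c _ _ _ _ isoG) (Aut_c_model p).
Qed.
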